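(* (1) Let $R$ be a noetherian $QR$-domain. Then each subset of $\mathrm{Spec}(R)$ has the P.A-property. (2) Let $R$ be a Prüfer domain. If each $\mathcal{A}\subseteq \mathrm{Spec}(R)$ has the P.A-property, then $R$ is a $QR$-domain. (3) If $R$ is a Dedekind domain, then each subset of $\mathrm{Spec}(R)$ has the P.A-property if and only if $R$ is a $QR$-domain (if and only if $R$ has torsion class group).
   Context: All rings are commutative with $1\neq 0$. An overring of an integral domain $D$ with quotient field $K$ is a ring $T$ with $D\subseteq T\subseteq K$. An integral domain $D$ is a $QR$-domain if each overring of $D$ is a localization (ring of quotients) of $D$ with respect to a multiplicatively closed subset of $D$. A set $\mathcal{A}\subseteq \mathrm{Spec}(R)$ has the P.A-property (prime avoidance property) if whenever an ideal $I$ of $R$ satisfies $I\subseteq\bigcup_{P\in\mathcal{A}}P$, there exists $P\in\mathcal{A}$ with $I\subseteq P$. *)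

(* Defs.v *)
From HB Require Import structures.
From mathcomp Require Import all_boot all_order all_algebra.
From mathcomp Require Import all_classical.

Set Implicit Arguments.
Unset Strict Implicit.
Unset Printing Implicit Defensive.

Import GRing.Theory.
Local Open Scope classical_set_scope.
Local Open Scope ring_scope.

Notation "x %:F" := (@FracField.tofrac _ x) (format "x %:F") : ring_scope.

Section Ideals.
Variable R : comNzRingType.
Implicit Types I J P S : set R.

(* The unit ideal is allowed, unlike in [idealr_closed]. *)
Definition is_ideal I :=
  [/\ I 0, forall x y, I x -> I y -> I (x + y) & forall a x, I x -> I (a * x)].

Definition is_prime_ideal P :=
  [/\ is_ideal P, ~ P 1 & forall a b, P (a * b) -> P a \/ P b].

Definition is_maximal_ideal P :=
  [/\ is_ideal P, ~ P 1 &
      forall J, is_ideal J -> P `<=` J -> J = P \/ J = setT].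

Definition Spec : set (set R) := [set P | is_prime_ideal P].

Definition PA_property (A : set (set R)) :=
  forall I, is_ideal I -> I `<=` \bigcup_(P in A) P ->
  exists2 P, A P & I `<=` P.

Definition ideal_gen (G : set R) : set R := smallest is_ideal G.

Definition fin_gen_ideal I := exists s : seq R, I = ideal_gen [set` s].

Definition noetherian := forall I, is_ideal I -> fin_gen_ideal I.

Definition mult_closed S := mulr_closed [in S].

End Ideals.

Arguments Spec : clear implicits.
Arguments noetherian : clear implicits.

Section Overrings.
Variable R : idomainType.
Local Notation K := {fraction R}.

Definition overring (T : set K) :=
  subring_closed [in T] /\ range (@FracField.tofrac R) `<=` T.

Definition localization (S : set R) : set K :=
  [set x | exists a s : R, S s /\ x = a%:F / s%:F].

(* [~ S 0]: otherwise the ring of quotients is zero, hence not inside [K]. *)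
Definition QR_domain :=
  forall T : set K, overring T ->
  exists S : set R, [/\ mult_closed S, ~ S 0 & T = localization S].

Definition integrally_closed :=
  forall x : K, integralOver (@FracField.tofrac R) x ->
  range (@FracField.tofrac R) x.

(* Fields are included. *)
Definition dedekind_domain :=
  [/\ noetherian R, integrally_closed &
      forall P, Spec R P -> P <> [set 0] -> is_maximal_ideal P].

End Overrings.

Arguments QR_domain : clear implicits.
Arguments integrally_closed : clear implicits.
Arguments dedekind_domain : clear implicits.

Section FractionalIdeals.
Variable R : idomainType.
Local Notation K := {fraction R}.
Implicit Types I J L : set K.

Definition is_submodule I :=
  [/\ I 0, forall x y, I x -> I y -> I (x + y) &
      forall (a : R) x, I x -> I (a%:F * x)].

Definition fractional_ideal I :=
  is_submodule I /\
  exists2 d : R, d != 0 & forall x, I x -> exists a : R, d%:F * x = a%:F.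

Definition mulI I J : set K :=
  smallest is_submodule [set x * y | x in I & y in J].

Definition unitI : set K := range (@FracField.tofrac R).

Definition principalI (x : K) : set K := range (fun a : R => x * a%:F).

Definition invertible I :=
  fractional_ideal I /\ exists2 J, fractional_ideal J & mulI I J = unitI.

Definition prufer_domain :=
  forall A : set R, fin_gen_ideal A -> A <> [set 0] ->
  invertible [set a%:F | a in A].

Lemma mulI_submodule I J : is_submodule (mulI I J).
Proof.
split=> [M [[]] //|x y Ix Iy M PM|a x Ix M PM].
- have [[_ MD _] _] := PM; exact: MD (Ix M PM) (Iy M PM).
- have [[_ _ MZ] _] := PM; exact: MZ (Ix M PM).
Qed.

Lemma mulI_in I J x y : I x -> J y -> mulI I J (x * y).
Proof. by move=> Ix Jy M [_]; apply; exists x => //; exists y. Qed.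

Lemma mulI_sub I J L : is_submodule L ->
  (forall x y, I x -> J y -> L (x * y)) -> mulI I J `<=` L.
Proof.
by move=> sL IJL; apply: smallest_sub => // _ [x Ix [y Jy <-]]; apply: IJL.
Qed.

Lemma mulIC I J : mulI I J = mulI J I.
Proof.
by apply/seteqP; split; apply: mulI_sub (mulI_submodule _ _) _ => x y xP yP;
  rewrite mulrC; apply: mulI_in.
Qed.

Lemma submodule_scale L (x : K) :
  is_submodule L -> is_submodule [set z | L (x * z)].
Proof.
case=> L0 LD LZ; split=> /= [|y z|a y]; rewrite ?mulr0 ?mulrDr //.
- exact: LD.
- by rewrite mulrCA; apply: LZ.
Qed.

Lemma mulIA I J L : mulI I (mulI J L) = mulI (mulI I J) L.
Proof.
have sub A B C : mulI A (mulI B C) `<=` mulI (mulI A B) C.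
  apply: mulI_sub (mulI_submodule _ _) _ => x z Ax.
  apply: (mulI_sub (L := [set z | mulI (mulI A B) C (x * z)])) => [|y t By Ct].
    exact: submodule_scale (mulI_submodule _ _).
  by rewrite /= mulrA; apply: mulI_in => //; apply: mulI_in.
apply/seteqP; split; first exact: sub.
by rewrite mulIC (mulIC I J) (mulIC I) (mulIC J L); apply: sub.
Qed.

Lemma mul1I I : is_submodule I -> mulI unitI I = I.
Proof.
move=> sI; apply/seteqP; split.
  by apply: mulI_sub => // _ y [a _ <-]; case: sI => _ _; apply.
move=> x Ix; rewrite -[x]mul1r; apply: mulI_in => //.
by exists 1 => //; rewrite rmorph1.
Qed.

Lemma principal_submodule x : is_submodule (principalI x).
Proof.
split=> [|_ _ [a _ <-] [b _ <-]|b _ [a _ <-]].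
- by exists 0 => //; rewrite rmorph0 mulr0.
- by exists (a + b) => //; rewrite rmorphD mulrDr.
- by exists (b * a) => //; rewrite rmorphM mulrCA.
Qed.

Lemma unitIE : unitI = principalI 1.
Proof. by apply/seteqP; split=> _ [a _ <-]; exists a; rewrite ?mul1r. Qed.

Lemma mulI_principal x y :
  mulI (principalI x) (principalI y) = principalI (x * y).
Proof.
apply/seteqP; split.
  apply: mulI_sub (principal_submodule _) _ => _ _ [a _ <-] [b _ <-].
  by exists (a * b) => //; rewrite rmorphM mulrACA.
move=> _ [a _ <-]; rewrite -mulrA.
by apply: mulI_in; [exists 1; rewrite ?rmorph1 ?mulr1 | exists a].
Qed.

Lemma mulI_fractional I J :
  fractional_ideal I -> fractional_ideal J -> fractional_ideal (mulI I J).
Proof.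
move=> [_ [d d0 dI]] [_ [e e0 eJ]]; split; first exact: mulI_submodule.
exists (d * e); first by rewrite mulf_neq0.
apply: (mulI_sub (L := [set x | exists a, (d * e)%:F * x = a%:F])).
  split=> /= [|x y [a xE] [b yE]|c x [a xE]].
  - by exists 0; rewrite mulr0 rmorph0.
  - by exists (a + b); rewrite mulrDr xE yE rmorphD.
  - by exists (c * a); rewrite mulrCA xE rmorphM.
move=> x y /dI[a xE] /eJ[b yE]; exists (a * b).
by rewrite !rmorphM mulrACA xE yE.
Qed.

Lemma unitI_fractional : fractional_ideal unitI.
Proof.
split; first by rewrite unitIE; exact: principal_submodule.
by exists 1; rewrite ?oner_neq0 // => _ [a _ <-]; exists a; rewrite rmorph1 mul1r.
Qed.

Lemma unitI_invertible : invertible unitI.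
Proof.
split; first exact: unitI_fractional.
exists unitI; first exact: unitI_fractional.
by apply: mul1I; case: unitI_fractional.
Qed.

Lemma mulI_invertible I J :
  invertible I -> invertible J -> invertible (mulI I J).
Proof.
move=> [fI [I' fI' II']] [fJ [J' fJ' JJ']]; split; first exact: mulI_fractional.
exists (mulI J' I'); first exact: mulI_fractional.
rewrite -mulIA (mulIA J) JJ' mul1I //; by case: fI'.
Qed.

Lemma invertible_inv I : invertible I ->
  exists2 J, invertible J & mulI J I = unitI.
Proof.
move=> [fI [J fJ IJ]]; exists J; last by rewrite mulIC.
by split=> //; exists I; rewrite // mulIC.
Qed.

Record inv_ideal :=
  InvIdeal { ideal_set :> set K; inv_idealP : invertible ideal_set }.

HB.instance Definition _ := gen_eqMixin inv_ideal.
HB.instance Definition _ := gen_choiceMixin inv_ideal.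

Lemma inv_ideal_inj (A B : inv_ideal) : A = B :> set K -> A = B.
Proof.
by case: A B => [A pA] [B pB] /= AB; subst B; congr InvIdeal; exact: Prop_irrelevance.
Qed.

Definition invI_mul (A B : inv_ideal) :=
  InvIdeal (mulI_invertible (inv_idealP A) (inv_idealP B)).
Definition invI_one := InvIdeal unitI_invertible.
Definition invI_inv (A : inv_ideal) :=
  let: exist2 _ pJ _ := cid2 (invertible_inv (inv_idealP A)) in InvIdeal pJ.

Lemma invI_mulC : commutative invI_mul.
Proof. by move=> A B; apply: inv_ideal_inj; apply: mulIC. Qed.
Lemma invI_mulA : associative invI_mul.
Proof. by move=> A B C; apply: inv_ideal_inj; apply: mulIA. Qed.
Lemma invI_mul1 : left_id invI_one invI_mul.
Proof.
by move=> A; apply: inv_ideal_inj; apply: mul1I; case: (inv_idealP A) => -[].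
Qed.
Lemma invI_mulV : left_inverse invI_one invI_inv invI_mul.
Proof.
by move=> A; apply: inv_ideal_inj; rewrite /invI_inv; case: cid2.
Qed.
Lemma invI_mul1r : right_id invI_one invI_mul.
Proof. by move=> A; rewrite invI_mulC invI_mul1. Qed.
Lemma invI_mulVr : right_inverse invI_one invI_inv invI_mul.
Proof. by move=> A; rewrite invI_mulC invI_mulV. Qed.

HB.instance Definition _ :=
  isGroup.Build inv_ideal invI_mulA invI_mul1 invI_mul1r invI_mulV invI_mulVr.

Definition principal_inv_ideal (A : inv_ideal) :=
  exists2 x : K, x != 0 & ideal_set A = principalI x.

Local Open Scope group_scope.

Lemma principal_one : principal_inv_ideal 1.
Proof. by exists 1%R; [exact: oner_neq0 | exact: unitIE]. Qed.

Lemma principal_mul (A B : inv_ideal) :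
  principal_inv_ideal A -> principal_inv_ideal B -> principal_inv_ideal (A * B).
Proof.
move=> [x x0 Ax] [y y0 By]; exists (x * y)%R; first exact: mulf_neq0.
by rewrite /= Ax By mulI_principal.
Qed.

Lemma principal_inv (A : inv_ideal) :
  principal_inv_ideal A -> principal_inv_ideal A^-1.
Proof.
move=> [x x0 Ax]; exists (x^-1)%R; first by rewrite invr_eq0.
have VA : mulI (ideal_set A^-1) (ideal_set A) = unitI.
  exact: (congr1 ideal_set (mulVg A)).
have sV : is_submodule (ideal_set A^-1) by case: (inv_idealP A^-1) => -[].
rewrite -(mul1I sV) unitIE -(mulVf x0) -mulI_principal -Ax -mulIA.
by rewrite (mulIC (ideal_set A)) VA mulIC mul1I //; exact: principal_submodule.
Qed.

Definition same_class (A B : inv_ideal) := `[< principal_inv_ideal (A^-1 * B) >].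

Lemma same_class_refl : reflexive same_class.
Proof. by move=> A; apply/asboolP; rewrite mulVg; exact: principal_one. Qed.

Lemma same_class_sym : symmetric same_class.
Proof.
have imp A B : same_class A B -> same_class B A.
  by move=> /asboolP/principal_inv; rewrite invgM invgK => ?; apply/asboolP.
by move=> A B; apply/idP/idP; apply: imp.
Qed.

Lemma same_class_trans : transitive same_class.
Proof.
move=> B A C /asboolP AB /asboolP BC; apply/asboolP.
by have := principal_mul AB BC; rewrite mulgA mulgK.
Qed.

Canonical same_class_equiv :=
  EquivRel same_class same_class_refl same_class_sym same_class_trans.

(* Invertible fractional ideals modulo principal ones; for a Dedekind domain
   every nonzero fractional ideal is invertible, so this is its ideal class
   group. *)
Definition class_group := {eq_quot same_class_equiv}%qT.

HB.instance Definition _ := Choice.on class_group.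
HB.instance Definition _ := EqQuotient.on class_group.

Local Open Scope quotient_scope.

Definition ideal_class (A : inv_ideal) : class_group := \pi A.

Lemma ideal_classP (A B : inv_ideal) :
  ideal_class A = ideal_class B <-> principal_inv_ideal (A^-1 * B).
Proof. by split=> [/eqmodP/asboolP|p]; last exact/eqmodP/asboolP. Qed.

Lemma ideal_class_repr (c : class_group) : ideal_class (repr c) = c.
Proof. exact: reprK. Qed.

Definition class_mul (c d : class_group) := ideal_class (repr c * repr d).
Definition class_one := ideal_class 1.
Definition class_inv (c : class_group) := ideal_class (repr c)^-1.

Lemma ideal_classM (A B : inv_ideal) :
  ideal_class (A * B) = class_mul (ideal_class A) (ideal_class B).
Proof.
have /ideal_classP pA := esym (ideal_class_repr (ideal_class A)).
have /ideal_classP pB := esym (ideal_class_repr (ideal_class B)).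
apply/ideal_classP; have := principal_mul pA pB; congr principal_inv_ideal.
rewrite invgM (invI_mulC B^-1 A^-1 : B^-1 * A^-1 = A^-1 * B^-1) -[LHS]mulgA -[RHS]mulgA; congr (_ * _).
by rewrite [LHS]mulgA [RHS]mulgA; congr (_ * _); exact: invI_mulC.
Qed.

Lemma class_mulA : associative class_mul.
Proof.
move=> a b c; rewrite -(ideal_class_repr a) -(ideal_class_repr b).
by rewrite -(ideal_class_repr c) -!ideal_classM mulgA.
Qed.
Lemma class_mulC : commutative class_mul.
Proof. by move=> a b; congr ideal_class; exact: invI_mulC. Qed.
Lemma class_mul1 : left_id class_one class_mul.
Proof.
by move=> a; rewrite -(ideal_class_repr a) -ideal_classM mul1g.
Qed.
Lemma class_mulV : left_inverse class_one class_inv class_mul.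
Proof.
by move=> a; rewrite -{2}(ideal_class_repr a) -ideal_classM mulVg.
Qed.
Lemma class_mul1r : right_id class_one class_mul.
Proof. by move=> a; rewrite class_mulC class_mul1. Qed.
Lemma class_mulVr : right_inverse class_one class_inv class_mul.
Proof. by move=> a; rewrite class_mulC class_mulV. Qed.

HB.instance Definition _ :=
  isGroup.Build class_group class_mulA class_mul1 class_mul1r class_mulV class_mulVr.

End FractionalIdeals.

Arguments prufer_domain : clear implicits.
Arguments class_group : clear implicits.

Definition torsion_group (G : groupType) :=
  forall g : G, exists2 n : nat, (0 < n)%N & (g ^+ n = 1)%g.

(* Main.v *)
Require Import Defs.
From mathcomp Require Import all_boot all_order all_algebra.
From mathcomp Require Import all_classical.
From mathcomp Require Import ring zify.

Set Implicit Arguments.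
Unset Strict Implicit.
Unset Printing Implicit Defensive.

(** Everything goes through one intermediate property of a domain [R]: every
prime ideal is the radical of a principal ideal ([radical_principal]).

This property is equivalent to prime avoidance for all subsets of [Spec R]
([PA_radical_principal], [radical_principal_PA]). If prime avoidance holds, apply
it to a prime [P] and the set of primes not containing [P]: some [s] in [P] lies
in no such prime, so every prime containing [s] contains [P]. Conversely, if an
ideal [I] lies in the union of a set of primes, Krull's lemma gives a prime [Q]
containing [I] and still inside the union; writing [Q] as the radical of [s], any
member of the set that contains [s] contains [Q].

It remains to compare the property with the QR condition. The link between
overrings and elements of [R] is that in a QR-domain any element of an overring
[T] is a fraction whose denominator is invertible in [T] ([QR_inv]).

- A noetherian QR-domain has the property ([QR_radical_principal]). For a nonzero
  prime [P], let [T] be the set of [x] that are multiplied into [R] by some power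
  of each element of [P]. A denominator [s] has [1 / s] in [T] exactly when [s]
  divides a power of each element of [P], so it is enough to find a denominator in
  [P], and for this that [T] is not contained in the localization at [P]. This
  follows because [P] is locally principal, by [QR_arithmetical].

- A Pruefer domain with the property is a QR-domain ([radical_principal_QR]). For
  [x] in an overring [T], the ideal of denominators of [x] generates the unit
  ideal of [T]; a prime containing it is the radical of some [q], and then [q] is
  invertible in [T]. So no prime contains the denominators and avoids the elements
  of [R] invertible in [T].

Both arguments use invertibility of two-generated ideals only through the
elementwise condition [arithmetical]. Pruefer domains have it by definition of
invertibility; for QR-domains it comes from applying the QR condition to [R[x]],
which first gives integral closedness and then, with [x = a / b], the condition
for [a] and [b].

For a Dedekind domain, every nonzero ideal can be reached from [R] by multiplying
by nonzero primes ([dedekind_ideal_ind]). This yields that nonzero ideals are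
invertible, so that the domain is Pruefer; that an ideal whose radical is a prime
[P] is a power of [P], so that a principal ideal with radical [P] makes the class
of [P] torsion; and that torsion of the classes of primes gives torsion of the
class group. Conversely a principal power of [P] exhibits [P] as the radical of
its generator. *)

Local Open Scope classical_set_scope.

(** * Ideals and prime avoidance *)

Section Ideals.
Local Open Scope ring_scope.
Import GRing.Theory.

(** The version of Zorn's lemma to use for families of ideals: the empty chain is
excluded because its union, the empty set, is not an ideal. Adding the empty set to
the family reduces to the version in which every chain has its union in the
family. *)
Lemma Zorn_inhabited_chains (T : Type) (C : set (set T)) (X0 : set T) : C X0 ->
  (forall F : set (set T), F `<=` C -> F !=set0 -> total_on F subset ->
    C (\bigcup_(X in F) X)) ->
  exists2 M, C M & forall X, C X -> M `<=` X -> X = M.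
Proof.
move=> CX0 Cchain.
have [|M [PM maxM]] := @Zorn_bigcup T [set X | C X \/ X = set0].
  move=> F FP totF; have [F0|nF0] := pselect ((F `&` C) !=set0); last first.
    right; apply/seteqP; split=> // x [X FX Xx].
    case: (FP _ FX) => [CX|X0E]; first by case: nF0; exists X.
    by rewrite X0E in Xx.
  left; suff -> : \bigcup_(X in F) X = \bigcup_(X in F `&` C) X.
    by apply: Cchain => // X Y [FX _] [FY _]; apply: totF.
  apply/seteqP; split=> x [X FX Xx]; last by exists X => //; case: FX.
  exists X => //; split=> //; case: (FP _ FX) => // X0E.
  by rewrite X0E in Xx.
have maxM' X : C X -> M `<=` X -> X = M.
  move=> CX MX; apply/seteqP; split=> //; apply: contrapT => nXM.
  by apply: (maxM X); [split | left].
exists M => //; case: PM => // M0.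
by rewrite -(maxM' _ CX0) // M0; apply: sub0set.
Qed.

Variable R : comNzRingType.
Implicit Types (I J P Q S : set R) (a b p r s x y : R).

Lemma ideal0 I : is_ideal I -> I 0. Proof. by case. Qed.
Lemma idealD I x y : is_ideal I -> I x -> I y -> I (x + y).
Proof. by case=> _ + _; apply. Qed.
Lemma idealMl I a x : is_ideal I -> I x -> I (a * x).
Proof. by case=> _ _; apply. Qed.
Lemma idealMr I a x : is_ideal I -> I x -> I (x * a).
Proof. by rewrite mulrC; apply: idealMl. Qed.

Lemma ideal1_setT I : is_ideal I -> I 1 -> I = setT.
Proof.
by move=> iI I1; apply/seteqP; split=> // x _; rewrite -[x]mulr1; apply: idealMl.
Qed.

Lemma ideal_gen_ideal (G : set R) : is_ideal (ideal_gen G).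
Proof.
split=> [M [[]]//|x y xG yG M|a x xG M] iM.
  by apply: (idealD iM.1); [apply: xG | apply: yG].
by apply: (idealMl _ iM.1); apply: xG.
Qed.

Lemma ideal_gen_in (s : seq R) x : x \in s -> ideal_gen [set` s] x.
Proof. by move=> xs M [_]; apply. Qed.

Lemma ideal_gen_sub (s : seq R) I :
  is_ideal I -> (forall x, x \in s -> I x) -> ideal_gen [set` s] `<=` I.
Proof. by move=> iI sI x; apply. Qed.

Lemma bigcup_chain_ideal (F : set (set R)) :
  F `<=` is_ideal (R := R) -> F !=set0 -> total_on F subset ->
  is_ideal (\bigcup_(I in F) I).
Proof.
move=> Fid [I0 FI0] totF; split.
- by exists I0 => //; apply: ideal0 (Fid _ FI0).
- move=> x y [I FI Ix] [J FJ Jy]; have [IJ|JI] := totF _ _ FI FJ.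
    by exists J => //; apply: (idealD (Fid _ FJ)) => //; apply: IJ.
  by exists I => //; apply: (idealD (Fid _ FI)) => //; apply: JI.
- by move=> a x [I FI Ix]; exists I => //; apply: idealMl (Fid _ FI) _.
Qed.

(** The union of a chain of ideals is finitely generated, and finitely many
generators already lie in one member of the chain, which is then the union. *)
Lemma noetherian_maximal (C : set (set R)) : noetherian R ->
  C `<=` is_ideal (R := R) -> C !=set0 ->
  exists2 M, C M & forall I, C I -> M `<=` I -> I = M.
Proof.
move=> noethR Cid [I0 CI0]; apply: Zorn_inhabited_chains CI0 _ => F FC F0 totF.
have iU := bigcup_chain_ideal (subset_trans FC Cid) F0 totF.
have [s sE] := noethR _ iU.
have sU x : x \in s -> (\bigcup_(I in F) I) x.
  by rewrite sE; apply: ideal_gen_in.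
have [I FI sI] : exists2 I, F I & forall x, x \in s -> I x.
  elim: s sU {sE} => [|x s IHs] sU; first by have [I FI] := F0; exists I.
  have [|I FI sI] := IHs; first by move=> y ys; apply: sU; rewrite inE ys orbT.
  have [|J FJ Jx] := sU x; first by rewrite mem_head.
  have [IJ|JI] := totF _ _ FI FJ.
    by exists J => // y /[!inE] /predU1P[->//|/sI/IJ].
  by exists I => // y /[!inE] /predU1P[->|/sI//]; apply: JI.
suff -> : \bigcup_(I in F) I = I by apply: FC.
apply/seteqP; split=> [|x Ix]; last by exists I.
by rewrite sE; apply: ideal_gen_sub => //; apply/Cid/FC.
Qed.

(** Krull's lemma: an ideal maximal among those disjoint from a multiplicative set
is prime. *)
Lemma exists_prime_disjoint S I :
  S 1 -> (forall x y, S x -> S y -> S (x * y)) ->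
  is_ideal I -> (forall x, I x -> ~ S x) ->
  exists Q, [/\ Spec R Q, I `<=` Q & forall x, Q x -> ~ S x].
Proof.
move=> S1 SM iI IS.
pose C := [set J | [/\ is_ideal J, I `<=` J & forall x, J x -> ~ S x]].
have [|F FC F0 totF|Q [iQ IQ QS] maxQ] := @Zorn_inhabited_chains R C I.
- by split.
- split.
  + by apply: bigcup_chain_ideal => // J /FC[].
  + by have [J FJ] := F0 => x Ix; exists J => //; case: (FC _ FJ) => _ + _; apply.
  + by move=> x [J FJ]; case: (FC _ FJ) => _ _; apply.
exists Q; split=> //; split=> [//|Q1|]; first exact: (QS 1).
pose adjoin a := [set x | exists m r, Q m /\ x = m + r * a].
have meets a : ~ Q a -> exists m r, Q m /\ S (m + r * a).
  move=> nQa; apply: contrapT => nS.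
  have QA : Q `<=` adjoin a by move=> m Qm; exists m, 0; rewrite mul0r addr0.
  suff CA : C (adjoin a).
    apply: nQa; rewrite -(maxQ _ CA QA); exists 0, 1.
    by split; [apply: ideal0 | rewrite mul1r add0r].
  split; [split| |].
  - by exists 0, 0; rewrite mul0r addr0; split=> //; apply: ideal0.
  - move=> _ _ [m [r [Qm ->]]] [m' [r' [Qm' ->]]]; exists (m + m'), (r + r').
    by split; [apply: idealD | ring].
  - move=> c _ [m [r [Qm ->]]]; exists (c * m), (c * r).
    by split; [apply: idealMl | ring].
  - exact: subset_trans IQ QA.
  - by move=> _ [m [r [Qm ->]]] Sx; apply: nS; exists m, r.
move=> a b Qab; apply: contrapT => /not_orP[/meets[m [r [Qm Sx]]] /meets[n [t [Qn Sy]]]].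
apply: QS (SM _ _ Sx Sy).
have -> : (m + r * a) * (n + t * b) = (n + t * b) * m + (r * a) * n + (r * t) * (a * b).
  by ring.
by apply: idealD => //; [apply: idealD => // |]; apply: idealMl.
Qed.

Lemma prime_exp P p n : Spec R P -> P (p ^+ n) -> P p.
Proof.
move=> [_ nP1 PM]; elim: n => [|n IHn]; first by rewrite expr0.
by rewrite exprS => /PM[].
Qed.

Lemma prime_ideal P : Spec R P -> is_ideal P. Proof. by case. Qed.

(** For a prime [P] the condition on [s] says that [P] is the radical of [s R]. *)
Definition radical_principal P :=
  exists2 s, P s & forall p, P p -> exists n r, p ^+ n = r * s.

Lemma PA_radical_principal :
  (forall A, A `<=` Spec R -> PA_property A) ->
  forall P, Spec R P -> radical_principal P.
Proof.
move=> PA P sP.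
pose A := [set Q | Spec R Q /\ ~ P `<=` Q].
  (* Prime avoidance would put [P] inside a prime of [A], against the choice
     of [A]; so some [s] in [P] is in no prime of [A]. *)
have [PU|/existsNP[s /not_implyP[Ps nUs]]] := pselect (P `<=` \bigcup_(Q in A) Q).
  have [|Q [_ nPQ] PQ //] := PA A _ P (prime_ideal sP) PU.
  by move=> Q [].
exists s => // p Pp; apply: contrapT => nps.
(* A prime containing [s] but not [p] would belong to [A]. *)
have := @exists_prime_disjoint [set p ^+ n | n in setT] [set r * s | r in setT].
case=> [||||Q [sQ sQs dQ]].
- by exists 0%N.
- by move=> _ _ [n _ <-] [m _ <-]; exists (n + m)%N; rewrite ?exprD.
- split=> [|_ _ [r _ <-] [t _ <-]|a _ [r _ <-]].
  + by exists 0; rewrite ?mul0r.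
  + by exists (r + t); rewrite ?mulrDl.
  + by exists (a * r); rewrite ?mulrA.
- by move=> _ [r _ <-] [n _ E]; apply: nps; exists n, r.
apply: nUs; exists Q; last by apply: sQs; exists 1; rewrite ?mul1r.
by split=> // PQ; apply: (dQ p); [apply: PQ | exists 1%N; rewrite ?expr1].
Qed.

Lemma radical_principal_PA :
  (forall P, Spec R P -> radical_principal P) ->
  forall A, A `<=` Spec R -> PA_property A.
Proof.
move=> radR A AS I iI IU.
(* The complement of a union of primes is multiplicative. *)
have [||||Q [sQ IQ dQ]] :=
    @exists_prime_disjoint (~` \bigcup_(P in A) P) I.
- by case=> P /AS[_ + _].
- move=> x y nUx nUy [P AP]; have [_ _ /[apply]] := AS _ AP.
  by case=> [Px|Py]; [apply: nUx | apply: nUy]; exists P.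
- exact: iI.
- by move=> x /IU Ux; apply.
have [s Qs Qrad] := radR _ sQ.
have [P AP Ps] := contrapT (dQ _ Qs).
exists P => // x /IQ/Qrad[n [r xE]]; apply: (@prime_exp _ _ n); first exact: AS.
by rewrite xE; apply: idealMl (prime_ideal (AS _ AP)) Ps.
Qed.

End Ideals.

(** * Overrings and integral elements *)

Section QRDomains.
Local Open Scope ring_scope.
Import GRing.Theory.

Variable R : idomainType.
Local Notation K := {fraction R}.
Local Notation tofrac := (@FracField.tofrac R).
Implicit Types (a b c d p q r s t u v : R) (x y z : K) (I J P Q S : set R) (T : set K).

Lemma tofrac_inj : injective tofrac.
Proof. by move=> a b /eqP; rewrite tofrac_eq => /eqP. Qed.

Lemma fraction_div x : exists a b, b != 0 /\ x = a%:F / b%:F.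
Proof.
elim/quotW: x => x; have d0 := denom_ratioP x.
exists (frac x).1, (frac x).2; split=> //.
apply: (mulIf (x := (frac x).2%:F)); first by rewrite tofrac_eq0.
rewrite divfK ?tofrac_eq0 //; unlock FracField.tofrac.
rewrite -[LHS]FracField.pi_mul; apply/eqmodP; rewrite /= FracField.equivfE.
by rewrite /FracField.mulf !numden_Ratio ?mulf_neq0 ?oner_neq0 // !mulr1 mulrC.
Qed.

Lemma overringP T : overring T <->
  [/\ forall a, T a%:F, forall x y, T x -> T y -> T (x - y) &
      forall x y, T x -> T y -> T (x * y)].
Proof.
split=> [[[_ TB TM] RT]|[RT TB TM]].
  split=> [a|x y Tx Ty|x y Tx Ty]; first by apply: RT; exists a.
  - by apply/set_mem/TB; apply: mem_set.
  - by apply/set_mem/TM; apply: mem_set.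
split; last by move=> _ [a _ <-].
split=> [|x y|x y]; rewrite !in_setE.
- by rewrite -tofrac1; apply: RT.
- exact: TB.
- exact: TM.
Qed.

Lemma overringD T x y : overring T -> T x -> T y -> T (x + y).
Proof.
move=> /overringP[RT TB _] Tx Ty; rewrite -[y]opprK; apply: (TB) => //.
by rewrite -[- y]add0r -tofrac0; apply: TB.
Qed.

(** This is the only form in which the QR condition is used: the denominator [s]
can be taken invertible in [T]. *)
Lemma QR_inv T : QR_domain R -> overring T -> forall x, T x ->
  exists a s, [/\ s != 0, x = a%:F / s%:F & T s%:F^-1].
Proof.
move=> QR /QR[S [_ S0 ->]] x [a [s [Ss ->]]]; exists a, s; split=> //.
  by apply: contra_notN S0 => /eqP <-.
by exists 1, s; rewrite rmorph1 div1r.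
Qed.

Definition adjoin x : set K :=
  [set (map_poly tofrac f).[x] | f in [set: {poly R}]].

Lemma adjoin_overring x : overring (adjoin x).
Proof.
apply/overringP; split=> [a|_ _ [f _ <-] [g _ <-]|_ _ [f _ <-] [g _ <-]].
- by exists a%:P; rewrite // map_polyC hornerC.
- by exists (f - g); rewrite // rmorphB hornerD hornerN.
- by exists (f * g); rewrite // rmorphM hornerM.
Qed.

Lemma adjoin_id x : adjoin x x.
Proof. by exists 'X; rewrite // map_polyX hornerX. Qed.

(** Multiply a monic equation of degree [n] for [1 / s] by [s ^+ n]: all terms but
the leading one are multiples of [s], so [s] divides [1]. *)
Lemma inv_integral s : s != 0 -> integralOver tofrac s%:F^-1 -> range tofrac s%:F^-1.
Proof.
move=> s0 [f fM /rootP f0].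
have sF0 : s%:F != 0 by rewrite tofrac_eq0.
have f_gt0 : (0 < size f)%N by rewrite size_poly_gt0 monic_neq0.
set n := (size f).-1.
have sz : (size (map_poly tofrac f) <= n.+1)%N by rewrite prednK // size_poly.
pose t := \sum_(i < n) f`_i * s ^+ (n.-1 - i).
have fE : s%:F ^+ n * (map_poly tofrac f).[s%:F^-1] = 1 + s%:F * t%:F.
  rewrite (horner_coef_wide _ sz) big_ord_recr /= mulrDr addrC; congr (_ + _).
    rewrite coef_map /= -[f`_n]/(lead_coef f) (monicP fM) rmorph1 mul1r.
    by rewrite -exprMn divff // expr1n.
  rewrite rmorph_sum !mulr_sumr; apply: eq_bigr => i _.
  rewrite coef_map rmorphM rmorphXn /= mulrCA [RHS]mulrCA; congr (_ * _).
  have nE : n = (i + (n.-1 - i).+1)%N by have := ltn_ord i; lia.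
  rewrite [X in _ ^+ X * _]nE exprD mulrAC -exprMn divff //.
  by rewrite expr1n mul1r exprS.
exists (- t) => //; apply: (mulfI sF0); rewrite divff // rmorphN mulrN.
by apply/eqP; rewrite eq_sym -addr_eq0 -fE f0 mulr0.
Qed.

(** If [x] is integral then so is every element of [R[x]], in particular the
inverse of a denominator of [x] that is invertible in [R[x]]; that denominator is
thus a unit of [R]. *)
Lemma QR_integrally_closed : QR_domain R -> integrally_closed R.
Proof.
move=> QR x intx.
have [a [s [s0 xE [f _ fE]]]] := QR_inv QR (adjoin_overring x) (adjoin_id x).
have [|t _ tE] := inv_integral s0.
  rewrite -fE; apply: integral_horner intx; apply/integral_poly => i.
  by rewrite coef_map; apply: integral_id.
by exists (a * t); rewrite // tofracM xE tE.
Qed.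

(** The determinant trick: multiplication by [x] acts on the span of the [e i]
through a matrix over [R], and [x] is an eigenvalue of it, hence a root of its
characteristic polynomial. *)
Lemma integral_stable n (e : 'I_n -> K) x : (exists i, e i != 0) ->
  (forall i, exists c : 'I_n -> R, x * e i = \sum_j (c j)%:F * e j) ->
  integralOver tofrac x.
Proof.
move=> [i0 ei0] /choice[c cE].
pose A : 'M[R]_n := \matrix_(i, j) c j i.
exists (char_poly A); first exact: char_poly_monic.
rewrite map_char_poly -eigenvalue_root_char; apply/eigenvalueP.
exists (\row_j e j).
  apply/rowP => i; rewrite !mxE cE; apply: eq_bigr => j _.
  by rewrite !mxE mulrC.
by apply: contra_neq ei0 => /rowP/(_ i0); rewrite !mxE.
Qed.

(** For nonzero [a] and [b] this says that the ideal [(a, b)] is invertible; locally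
at any prime one of [a] and [b] divides the other, as [r] and [1 - r] are not both
in the prime. *)
Definition arithmetical :=
  forall a b, exists r u v, r * a = u * b /\ (1 - r) * b = v * a.

(** Put [x = a / b]. A denominator [s] of [x] invertible in [R[x]] satisfies
[1 / s = c + x * f(x)] with [c] in [R], so that [u := 1 - s * c] equals
[s * f(x) * x]. Then [u / x = s * f(x)] is integral, hence in [R], and
the coefficients are [r = s * c] and [1 - r = u]. *)
Lemma QR_arithmetical : QR_domain R -> arithmetical.
Proof.
move=> QR a b.
have [->|b0] := eqVneq b 0; first by exists 0, 0, 0; rewrite !mul0r mulr0.
have [->|a0] := eqVneq a 0; first by exists 1, 0, 0; rewrite subrr !mul0r mulr0.
have aF0 : a%:F != 0 by rewrite tofrac_eq0.
have bF0 : b%:F != 0 by rewrite tofrac_eq0.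
set x := a%:F / b%:F; have x0 : x != 0 by rewrite mulf_neq0 ?invr_eq0.
have [d [s [s0 xE [f _]]]] := QR_inv QR (adjoin_overring x) (adjoin_id x).
have sF0 : s%:F != 0 by rewrite tofrac_eq0.
elim/poly_ind: f => [|f c _].
  by rewrite rmorph0 horner0 => /esym/eqP; rewrite invr_eq0 (negPf sF0).
rewrite rmorphD rmorphM /= map_polyX map_polyC /=.
rewrite hornerD hornerM hornerX hornerC; set fx := _.[x] => fE.
pose u := 1 - s * c.
have uE : u%:F = s%:F * fx * x.
  rewrite tofracB tofracM tofrac1 -(divff sF0) -fE; ring.
have [v _ vE] : range tofrac (u%:F / x).
  apply: QR_integrally_closed QR _ _.
  pose n := (size f).+1.
  have sz : (size (map_poly tofrac f) <= n)%N by rewrite leqW // size_poly.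
  (* The span of the powers of [x] up to the degree of [f] plus one is stable
     under [u / x], which sends [1] to [s * f(x)] and lowers the other powers. *)
  apply: (@integral_stable n (fun i => x ^+ i)) => [|[[|i] lti]].
  - by exists ord0; rewrite expr0 oner_neq0.
  - exists (fun j => s * f`_j); rewrite mulr1 uE mulfK // /fx.
    rewrite (horner_coef_wide _ sz) mulr_sumr; apply: eq_bigr => j _.
    by rewrite coef_map tofracM mulrA.
  - exists (fun j => if j == i :> nat then u else 0).
    rewrite (bigD1 (Ordinal (ltnW lti))) //= eqxx big1 => [|j]; last first.
      by rewrite -val_eqE /= => /negPf->; rewrite tofrac0 mul0r.
    by rewrite addr0 exprS mulrA divfK.
exists (s * c), (c * d), v; split; apply: tofrac_inj; rewrite !tofracM.
  have -> : a%:F = x * b%:F by rewrite divfK.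
  by rewrite xE; field.
by rewrite -/u vE /x invf_div mulrA divfK // mulrC.
Qed.

(** * Radicals of principal ideals and the QR condition *)

(** At a prime [P] the elements of [P] are totally preordered by divisibility, so
one of finitely many divides the others; [t] clears the local denominators. *)
Lemma arithmetical_locally_principal P (l : seq R) : arithmetical -> Spec R P ->
  (forall e : R, e \in l -> P e) ->
  exists d t, [/\ P d, ~ P t & forall e : R, e \in l -> exists c, t * e = c * d].
Proof.
move=> arR sP; have [iP nP1 PM] := sP.
elim: l => [|y l IHl] lP; first by exists 0, 1; split=> //; apply: ideal0.
have [|d [t [Pd nPt lE]]] := IHl; first by move=> x xl; apply: lP; rewrite inE xl orbT.
have [r [u [v [ryE rdE]]]] := arR y d.
have [Pr|nPr] := pselect (P r); last first.
  exists d, (t * r); split=> // [/PM[]//|x /[!inE] /predU1P[->|/lE[c txE]]].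
    by exists (t * u); rewrite -!mulrA ryE.
  by exists (r * c); rewrite mulrAC txE; ring.
have nPr1 : ~ P (1 - r).
  by move=> Pr1; apply: nP1; rewrite -(subrK r 1); apply: idealD.
exists y, (t * (1 - r)); split=> [|/PM[]//|x /[!inE] /predU1P[->|/lE[c txE]]].
- by apply: lP; rewrite mem_head.
- by exists (t * (1 - r)).
- by exists (c * v); rewrite mulrAC txE -!mulrA -rdE; ring.
Qed.

(** If [d] generates [P] locally, with [t * P] inside [d R] and [t] outside [P], then
[t / d] belongs to the overring [T] but not to the localization at [P]: each of
its denominators is in [P]. *)
Lemma QR_radical_principal : noetherian R -> QR_domain R ->
  forall P, Spec R P -> radical_principal P.
Proof.
move=> noethR QR P sP; have [iP nP1 PM] := sP.
have [P0|/existsNP[p0 /not_implyP[Pp0 /eqP p0N0]]] := pselect (forall p, P p -> p = 0).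
  exists 0; first exact: ideal0.
  by move=> p /P0 ->; exists 1%N, 0; rewrite mulr0 expr1.
have [l lE] := noethR _ iP.
have [x|d [t [Pd nPt ld]]] := @arithmetical_locally_principal P l (QR_arithmetical QR) sP.
  by rewrite lE; apply: ideal_gen_in.
have Pd_t p : P p -> exists c, t * p = c * d.
  rewrite lE; apply: (ideal_gen_sub (I := [set p | exists c, t * p = c * d])) ld _; split.
  - by exists 0; rewrite mulr0 mul0r.
  - by move=> x y [c xE] [c' yE]; exists (c + c'); rewrite mulrDr xE yE mulrDl.
  - by move=> a x [c xE]; exists (a * c); rewrite mulrCA xE mulrA.
have d0 : d != 0.
  apply: contra_notN nPt => /eqP d0; have [c] := Pd_t _ Pp0.
  move/eqP; rewrite d0 mulr0 mulf_eq0 (negPf p0N0) orbF => /eqP->.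
  exact: ideal0.
have dF0 : d%:F != 0 by rewrite tofrac_eq0.
pose T := [set x | forall p, P p -> exists n a, p%:F ^+ n * x = a%:F].
have oT : overring T.
  apply/overringP; split=> [a p _|x y Tx Ty p Pp|x y Tx Ty p Pp].
  - by exists 0%N, a; rewrite mul1r.
  - have [[n [a xE]] [m [b yE]]] := (Tx p Pp, Ty p Pp).
    exists (n + m)%N, (p ^+ m * a - p ^+ n * b).
    by rewrite tofracB !tofracM !tofracXn -xE -yE exprD; ring.
  - have [[n [a xE]] [m [b yE]]] := (Tx p Pp, Ty p Pp).
    by exists (n + m)%N, (a * b); rewrite tofracM -xE -yE exprD; ring.
have [|a [s [s0 tdE Ts]]] := QR_inv QR oT (x := t%:F / d%:F).
  move=> p /Pd_t[c tpE]; exists 1%N, c; rewrite expr1 mulrA -tofracM mulrC.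
  by rewrite (mulrC p) tpE tofracM mulrC mulfK.
have sF0 : s%:F != 0 by rewrite tofrac_eq0.
exists s => [|p /Ts[n [r rE]]].
  have : P (t * s).
    suff -> : t * s = a * d by apply: idealMl.
    apply: tofrac_inj; rewrite !tofracM.
    by rewrite -(divfK dF0 t%:F) tdE; field.
  by case/PM.
by exists n, r; apply: tofrac_inj; rewrite tofracXn tofracM -rE divfK.
Qed.

(** A form of the fact that powers of comaximal elements are comaximal, stated for
an additive [W] stable under [x] and [y] because it is used with a principal ideal
of an overring, which is only a subset of [K] here. *)
Lemma comaximal_powers (W : set K) (x y : K) n m : x + y = 1 ->
  (forall z z', W z -> W z' -> W (z + z')) ->
  (forall z, W z -> W (x * z)) -> (forall z, W z -> W (y * z)) ->
  W (x ^+ n) -> W (y ^+ m) -> W 1.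
Proof.
move=> xy1 WD Wx Wy Wn Wm.
have WxX z k : W z -> W (x ^+ k * z).
  by move=> Wz; elim: k => [|k IHk]; rewrite ?mul1r // exprS -mulrA; apply: Wx.
have WyX z k : W z -> W (y ^+ k * z).
  by move=> Wz; elim: k => [|k IHk]; rewrite ?mul1r // exprS -mulrA; apply: Wy.
have W_xy k i j : (n + m <= i + j + k)%N -> W (x ^+ i * y ^+ j).
  elim: k i j => [|k IHk] i j ijk; last first.
    rewrite -[_ * _]mulr1 -xy1 mulrDr mulrAC -exprSr -mulrA -exprSr.
    by apply: (WD); apply: IHk; lia.
  have [ni|ni] := leqP n i.
    by rewrite mulrC -(subnK ni) exprD; apply/WyX/WxX.
  have mj : (m <= j)%N by lia.
  by rewrite -(subnK mj) exprD; apply/WxX/WyX.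
rewrite -[1]mulr1 -[X in X * _](expr0 x) -[X in _ * X](expr0 y).
by apply: (W_xy (n + m)%N).
Qed.

(** The comparison of [a] and [b], where [x = a / b], provides [r] and [v] in the
ideal [J] of denominators of [x] with [r + v * x = 1]. If [J] is inside the radical
of [q] then powers of [r] and [v * x] are multiples of [q] in [T], hence so is
[1]. *)
Lemma radical_principal_QR : arithmetical ->
  (forall P, Spec R P -> radical_principal P) -> QR_domain R.
Proof.
move=> arR radR T oT; have [RT TB TM] := (overringP T).1 oT.
pose S := [set s : R | s != 0 /\ T s%:F^-1].
have SM : forall x y : R, S x -> S y -> S (x * y).
  move=> x y [x0 Tx] [y0 Ty]; split; first by rewrite mulf_neq0.
  by rewrite tofracM invfM; apply: TM.
have S1 : S 1 by split; rewrite ?oner_neq0 // tofrac1 invr1 -tofrac1.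
exists S; split; first by split=> [|x y]; rewrite !in_setE //; apply: SM.
  by case; rewrite eqxx.
apply/seteqP; split=> [x Tx|_ [a [s [[s0 Ts] ->]]]]; last exact: TM (RT a) Ts.
pose J := [set r | exists a, r%:F * x = a%:F].
have iJ : is_ideal J.
  split=> [|r s [a rE] [b sE]|c r [a rE]].
  - by exists 0; rewrite tofrac0 mul0r.
  - by exists (a + b); rewrite !tofracD mulrDl rE sE.
  - by exists (c * a); rewrite !tofracM -mulrA rE.
apply: contrapT => nTx.
have [r [a rE] Sr|Q [sQ JQ QS]] := exists_prime_disjoint S1 SM iJ.
  apply: nTx; exists a, r; split=> //; case: Sr => r0 _.
  by rewrite -rE mulrAC divff ?mul1r // tofrac_eq0.
have [q Qq Qrad] := radR _ sQ.
have [a [b [b0 xE]]] := fraction_div x.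
have bF0 : b%:F != 0 by rewrite tofrac_eq0.
have [r [u [v [raE rbE]]]] := arR a b.
have rxE : r%:F * x = u%:F.
  by apply: (mulIf bF0); rewrite -tofracM -raE xE mulrA divfK // tofracM.
have vxE : v%:F * x = 1 - r%:F.
  apply: (mulIf bF0); rewrite -tofrac1 -tofracB -tofracM rbE xE mulrA divfK //.
  by rewrite tofracM.
have [n [r' rnE]] : exists n c, r ^+ n = c * q by apply/Qrad/JQ; exists u.
have [m [v' vmE]] : exists n c, v ^+ n = c * q.
  by apply/Qrad/JQ; exists (1 - r); rewrite tofracB tofrac1.
pose W := [set z | exists2 t, T t & z = q%:F * t].
have [] : W 1.
  apply: (@comaximal_powers W r%:F (v%:F * x) n m).
  - by rewrite vxE addrC subrK.
  - move=> _ _ [t Tt ->] [t' Tt' ->]; exists (t + t'); last by rewrite mulrDr.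
    exact: overringD.
  - by move=> _ [t Tt ->]; exists (r%:F * t); [apply: TM | ring].
  - by move=> _ [t Tt ->]; exists (v%:F * x * t); [do !apply: (TM) | ring].
  - by exists r'%:F => //; rewrite -tofracXn rnE tofracM mulrC.
  - exists (v'%:F * x ^+ m); last by rewrite exprMn -tofracXn vmE tofracM; ring.
    apply: (TM) => //; elim: (m) => [|k IHk]; first by rewrite expr0 -tofrac1.
    by rewrite exprS; apply: TM.
move=> t Tt qtE; apply: (QS q) => //.
have q0 : q != 0.
  by apply/eqP => q0; move/eqP: qtE; rewrite q0 tofrac0 mul0r oner_eq0.
split=> //; suff -> : q%:F^-1 = t by [].
by apply: (mulfI (x := q%:F)); rewrite ?divff ?tofrac_eq0.
Qed.

(** If [J] is an inverse of [(a, b)] then [1 = a * u + b * v] with [u], [v] in [J],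
and [r = b * v] is the required coefficient. *)
Lemma prufer_arithmetical : prufer_domain R -> arithmetical.
Proof.
move=> prR a b.
have [->|a0] := eqVneq a 0; first by exists 1, 0, 0; rewrite subrr !mul0r mulr0.
pose A := ideal_gen [set` [:: a; b]].
have Aa : A a by apply: ideal_gen_in; rewrite mem_head.
have Ab : A b by apply: ideal_gen_in; rewrite !inE eqxx orbT.
have [||_ [J [sJ _] AJ]] := prR A; first by exists [:: a; b].
  by move=> A0; move: Aa; rewrite A0 => /eqP; rewrite (negPf a0).
pose L := [set z : K | exists u v : K, [/\ J u, J v & z = a%:F * u + b%:F * v]].
have [J0 JD JZ] := sJ.
have sL : is_submodule L.
  split=> [|_ _ [u [v [Ju Jv ->]]] [u' [v' [Ju' Jv' ->]]]|c _ [u [v [Ju Jv ->]]]].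
  - by exists 0, 0; split; rewrite // !mulr0 addr0.
  - by exists (u + u'), (v + v'); split; [exact: JD | exact: JD | ring].
  - by exists (c%:F * u), (c%:F * v); split; [exact: JZ | exact: JZ | ring].
have AJL : mulI [set c%:F | c in A] J `<=` L.
  apply: mulI_sub => // _ y [c Ac <-] Jy.
  have [c1 [c2 ->]] : exists c1 c2, c = c1 * a + c2 * b.
    pose I := [set e | exists c1 c2, e = c1 * a + c2 * b].
    apply: (@ideal_gen_sub _ [:: a; b] I) Ac; first split.
    - by exists 0, 0; rewrite !mul0r addr0.
    - by move=> _ _ [c1 [c2 ->]] [d1 [d2 ->]]; exists (c1 + d1), (c2 + d2); ring.
    - by move=> e _ [c1 [c2 ->]]; exists (e * c1), (e * c2); ring.
    - move=> e /=; rewrite !inE => /orP[]/eqP->; first by exists 1, 0; ring.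
      by exists 0, 1; ring.
  exists (c1%:F * y), (c2%:F * y); split; [exact: JZ | exact: JZ |].
  by rewrite tofracD !tofracM; ring.
have [u [v [Ju Jv uvE]]] : L 1 by apply: AJL; rewrite AJ -tofrac1; exists 1.
have AJR c y : A c -> J y -> exists e, c%:F * y = e%:F.
  move=> Ac Jy; have : mulI [set c%:F | c in A] J (c%:F * y).
    by apply: mulI_in => //; exists c.
  by rewrite AJ => -[e _ <-]; exists e.
have [r rE] := AJR _ _ Ab Jv; have [s sE] := AJR _ _ Aa Jv.
have [t tE] := AJR _ _ Ab Ju.
exists r, s, t; split; apply: tofrac_inj; rewrite !tofracM.
  by rewrite -rE -sE; ring.
rewrite tofracB tofrac1 -rE -tE uvE; ring.
Qed.

(** * Ideals of a Dedekind domain *)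

Local Notation emb I := [set a%:F | a in I].

Lemma emb_tofrac I a : emb I a%:F -> I a.
Proof. by case=> b Ib /tofrac_inj <-. Qed.

Lemma emb_submodule I : is_ideal I -> is_submodule (emb I).
Proof.
move=> iI; split=> [|_ _ [a Ia <-] [b Ib <-]|c _ [a Ia <-]].
- by exists 0; rewrite ?tofrac0 //; apply: ideal0.
- by exists (a + b); rewrite ?tofracD //; apply: idealD.
- by exists (c * a); rewrite ?tofracM //; apply: idealMl.
Qed.

Lemma neq0_ideal I : is_ideal I -> I <> [set 0] -> exists2 e, I e & e != 0.
Proof.
move=> iI I0; apply: contrapT => nI; apply: I0; apply/seteqP; split=> [e Ie|_ ->].
  by apply: contrapT => /eqP e0; apply: nI; exists e.
exact: ideal0.
Qed.

Lemma ideal_gen_sum (l : seq R) a : ideal_gen [set` l] a ->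
  exists c : 'I_(size l) -> R, a = \sum_i c i * l`_i.
Proof.
pose I := [set a | exists c : 'I_(size l) -> R, a = \sum_i c i * l`_i].
apply: (@ideal_gen_sub _ l I) => [|e el].
  split=> [|_ _ [c ->] [d ->]|b _ [c ->]].
  - by exists (fun=> 0); rewrite big1 // => i _; rewrite mul0r.
  - exists (fun i => c i + d i); rewrite -big_split; apply: eq_bigr => i _.
    by rewrite mulrDl.
  - exists (fun i => b * c i); rewrite mulr_sumr; apply: eq_bigr => i _.
    by rewrite mulrA.
have il : (index e l < size l)%N by rewrite index_mem.
exists (fun i => if i == Ordinal il then 1 else 0).
rewrite (bigD1 (Ordinal il)) //= eqxx mul1r nth_index // big1 ?addr0 // => i.
by move=> /negPf->; rewrite mul0r.
Qed.

Lemma integrally_closed_stable I e x :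
  integrally_closed R -> fin_gen_ideal I -> I e -> e != 0 ->
  (forall i, I i -> emb I (x * i%:F)) -> range tofrac x.
Proof.
move=> icR [l lE] Ie e0 xI; apply: icR.
apply: (@integral_stable (size l) (fun i => (l`_i)%:F)) => [|i].
  apply: contrapT => l0; move: Ie; rewrite lE => /ideal_gen_sum[c eE].
  move/eqP: e0; apply; rewrite eE big1 // => i _; have [->|li0] := eqVneq l`_i 0.
    by rewrite mulr0.
  by case: l0; exists i; rewrite tofrac_eq0.
have [|j] := xI l`_i; first by rewrite lE; apply: ideal_gen_in; apply: mem_nth.
rewrite lE => /ideal_gen_sum[c jE] xE; exists c.
by rewrite -xE jE rmorph_sum; apply: eq_bigr => k _ /=; rewrite tofracM.
Qed.

Section Dedekind.
Hypothesis dedR : dedekind_domain R.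

(** The element is [b / a], where [a] is a nonzero element of [P] and the colon ideal
[M] of the [r] with [a] dividing [r * b] is maximal among the colon ideals inside
[P]. In dimension one [P] is minimal over [a], so each [p] in [P] satisfies
[p ^+ k * u * b] in [a R] for some [u] outside [P]; the maximality of [M] brings
this down to [p * b] in [a R]. Thus [M = P], and [b] is not in [a R]. *)
Lemma dedekind_prime_colon P : Spec R P -> P <> [set 0] ->
  exists2 x, ~ range tofrac x & forall p, P p -> range tofrac (x * p%:F).
Proof.
have [noethR _ maxR] := dedR.
move=> sP P0; have [iP nP1 PM] := sP; have [a Pa a0] := neq0_ideal iP P0.
pose colon b := [set r | exists c, r * b = c * a].
have icolon b : is_ideal (colon b).
  split=> [|r s [c rE] [d sE]|e r [c rE]].
  - by exists 0; rewrite !mul0r.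
  - by exists (c + d); rewrite !mulrDl rE sE.
  - by exists (e * c); rewrite -!mulrA rE.
pose C := [set J | J `<=` P /\ exists b, J = colon b].
have [||M [MP [b ME]] maxM] := @noetherian_maximal _ C noethR.
- by move=> _ [_ [b ->]]; apply: icolon.
- exists (colon 1); split; last by exists 1.
  by move=> r [c]; rewrite mulr1 => ->; apply: idealMl.
(* A prime containing [a] and avoiding all [p ^+ k * u] would be nonzero and
   strictly inside [P], against the maximality of nonzero primes. *)
have PprimM p : P p -> exists k u, ~ P u /\ colon 1 (p ^+ k * u).
  move=> Pp; apply: contrapT => nk.
  pose S := [set s | exists k u, ~ P u /\ s = p ^+ k * u].
  have [|||_ [c _ <-]|Q [sQ aQ QS]] := @exists_prime_disjoint _ S (range ( *%R^~ a)).
  - by exists 0%N, 1; rewrite mulr1.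
  - move=> _ _ [k [u [nPu ->]]] [m [v [nPv ->]]]; exists (k + m)%N, (u * v).
    by split; [case/PM | rewrite exprD; ring].
  - split=> [|_ _ [c _ <-] [d _ <-]|e _ [c _ <-]].
    + by exists 0; rewrite ?mul0r.
    + by exists (c + d); rewrite ?mulrDl.
    + by exists (e * c); rewrite ?mulrA.
  - by case=> k [u [nPu E]]; apply: nk; exists k, u; split=> //; exists c; rewrite -E mulr1.
  have Qa : Q a by apply: aQ; exists 1; rewrite ?mul1r.
  have QP : Q `<=` P.
    by move=> y /QS nSy; apply: contrapT => nPy; apply: nSy; exists 0%N, y; rewrite mul1r.
  have Q0 : Q <> [set 0] by move=> QE; move: Qa; rewrite QE => /eqP; rewrite (negPf a0).
  have [_ _ /(_ P iP QP)] := maxR Q sQ Q0.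
  case=> PE; last by apply: nP1; rewrite PE.
  by apply: (QS p); [rewrite -PE | exists 1%N, 1; rewrite mulr1].
have PM' p : P p -> M p.
  move=> Pp; have [k [u [nPu [c]]]] := PprimM p Pp; rewrite mulr1 => kE.
  have : colon b (p ^+ k * u) by exists (c * b); rewrite kE mulrAC.
  elim: k u nPu {kE} => [|k IHk] u nPu kuE.
    by case: nPu; apply: MP; rewrite ME -[u]mul1r -(expr0 p).
  (* Either the colon ideal of [p ^+ k * u * b] is inside [P], so equal to [M],
     and it contains [p]; or one of its elements outside [P] lowers [k]. *)
  have [subP|/existsNP[r /not_implyP[[d rE] nPr]]] := pselect (colon (p ^+ k * u * b) `<=` P).
    rewrite -(maxM (colon (p ^+ k * u * b))).
    - by have [d dE] := kuE; exists d; rewrite -dE exprS !mulrA.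
    - by split=> //; exists (p ^+ k * u * b).
    - by rewrite ME => r [d rE]; exists (p ^+ k * u * d); rewrite mulrCA rE mulrA.
  apply: (IHk (u * r)); first by case/PM.
  by exists d; rewrite -rE; ring.
have aF0 : a%:F != 0 by rewrite tofrac_eq0.
exists (b%:F / a%:F) => [[r _ rE]|p /PM'].
  apply/nP1/MP; rewrite ME; exists r; apply: tofrac_inj.
  by rewrite mul1r tofracM rE divfK.
rewrite ME => -[c pE]; exists c => //; apply: (mulIf aF0).
by rewrite -tofracM -pE tofracM mulrAC divfK // mulrC.
Qed.

(** The ideal [P + x P] contains the maximal ideal [P]. It is not equal to it, for
otherwise [x P] is inside [P], and [x] is integral by the determinant trick; so it
is [R]. *)
Lemma dedekind_prime_comaximal P : Spec R P -> P <> [set 0] ->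
  exists x, [/\ ~ range tofrac x, forall p, P p -> range tofrac (x * p%:F) &
    exists p q, [/\ P p, P q & 1 = p%:F + x * q%:F]].
Proof.
have [noethR icR maxR] := dedR.
move=> sP P0; have [iP nP1 _] := sP; have [e Pe e0] := neq0_ideal iP P0.
have [x nRx xP] := dedekind_prime_colon sP P0; exists x; split=> //.
pose J := [set r | exists p q, [/\ P p, P q & r%:F = p%:F + x * q%:F]].
have iJ : is_ideal J.
  split=> [|r s [p [q [Pp Pq rE]]] [p' [q' [Pp' Pq' sE]]]|c r [p [q [Pp Pq rE]]]].
  - by exists 0, 0; split; rewrite ?tofrac0 ?mulr0 ?addr0 //; apply: ideal0.
  - exists (p + p'), (q + q'); split; [exact: idealD | exact: idealD |].
    by rewrite !tofracD rE sE; ring.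
  - exists (c * p), (c * q); split; [exact: idealMl | exact: idealMl |].
    by rewrite !tofracM rE; ring.
have PJ : P `<=` J.
  by move=> p Pp; exists p, 0; split=> //; [apply: ideal0 | rewrite tofrac0 mulr0 addr0].
have [_ _ /(_ J iJ PJ)] := maxR P sP P0.
case=> JE; last first.
  have [p [q [Pp Pq E]]] : J 1 by rewrite JE.
  by exists p, q; split=> //; rewrite -tofrac1.
case: nRx; apply: (integrally_closed_stable icR (noethR _ iP) Pe e0) => p Pp.
have [r _ rE] := xP p Pp; exists r => //; rewrite -JE; exists 0, p.
by split=> //; [apply: ideal0 | rewrite tofrac0 add0r].
Qed.

(** Noetherian induction. A proper nonzero ideal [I] lies in a maximal [Q], and [x]
such that [R + x R] is the inverse of [Q] gives [J = I + x I], an ideal of [R] with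
[J Q = I]. It is strictly larger than [I] by the determinant trick. *)
Lemma dedekind_ideal_ind (Phi : set K -> Prop) : Phi (@unitI R) ->
  (forall J Q, is_ideal J -> Spec R Q -> Q <> [set 0] ->
    Phi (emb J) -> Phi (mulI (emb J) (emb Q))) ->
  forall I, is_ideal I -> I <> [set 0] -> Phi (emb I).
Proof.
have [noethR icR maxR] := dedR.
move=> Phi1 PhiM I0 iI0 I00; apply: contrapT => nPhiI0.
pose C := [set I | [/\ is_ideal I, I <> [set 0] & ~ Phi (emb I)]].
have [||I [iI IN0 nPhiI] maxI] := @noetherian_maximal _ C noethR.
- by move=> I [].
- by exists I0.
have [e Ie e0] := neq0_ideal iI IN0.
have [//|||y Iy y1|Q [sQ IQ _]] := @exists_prime_disjoint _ [set 1] I.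
- by move=> _ _ -> ->; rewrite /= mulr1.
- exact: iI.
- by apply: nPhiI; rewrite (ideal1_setT iI) // -y1.
have QN0 : Q <> [set 0] by move=> QE; move/IQ: Ie; rewrite QE => /eqP; rewrite (negPf e0).
have [x [nRx xQ [p [q [Qp Qq pqE]]]]] := dedekind_prime_comaximal sQ QN0.
pose J := [set r | exists i j, [/\ I i, I j & r%:F = i%:F + x * j%:F]].
have iJ : is_ideal J.
  split=> [|r s [i [j [Ii Ij rE]]] [i' [j' [Ii' Ij' sE]]]|c r [i [j [Ii Ij rE]]]].
  - by exists 0, 0; split; rewrite ?tofrac0 ?mulr0 ?addr0 //; apply: ideal0.
  - exists (i + i'), (j + j'); split; [exact: idealD | exact: idealD |].
    by rewrite !tofracD rE sE; ring.
  - exists (c * i), (c * j); split; [exact: idealMl | exact: idealMl |].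
    by rewrite !tofracM rE; ring.
have IJ : I `<=` J.
  by move=> i Ii; exists i, 0; split=> //; [apply: ideal0 | rewrite tofrac0 mulr0 addr0].
have xIJ i : I i -> emb J (x * i%:F).
  move=> Ii; have [r _ rE] := xQ i (IQ _ Ii); exists r => //; exists 0, i.
  by split=> //; [apply: ideal0 | rewrite tofrac0 add0r].
have PhiJ : Phi (emb J).
  apply: contrapT => nPhiJ; apply: nRx.
  apply: (integrally_closed_stable icR (noethR _ iI) Ie e0) => i /xIJ.
  rewrite (maxI J) //; split=> // JE.
  by move/IJ: Ie; rewrite JE => /eqP; rewrite (negPf e0).
apply: nPhiI; suff -> : emb I = mulI (emb J) (emb Q) by apply: PhiM.
apply/seteqP; split.
  move=> _ [i Ii <-]; have [_ JQD _] := mulI_submodule (emb J) (emb Q).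
  have -> : i%:F = i%:F * p%:F + x * i%:F * q%:F by rewrite -[LHS]mulr1 pqE; ring.
  apply: JQD; apply: mulI_in; [exists i; by [|apply: IJ] | by exists p | exact: xIJ | by exists q].
apply: mulI_sub (emb_submodule iI) _ => _ _ [r [i [j [Ii Ij rE]]] <-] [s Qs <-].
have [t _ tE] := xQ s Qs; exists (i * s + j * t).
  by apply: idealD => //; apply: idealMr.
by rewrite rE tofracD !tofracM tE; ring.
Qed.

(** The inverse of a nonzero prime [Q] is [V = R + x R], for [x] as in
[dedekind_prime_comaximal]. *)
Lemma dedekind_invertible I : is_ideal I -> I <> [set 0] -> invertible (emb I).
Proof.
apply: dedekind_ideal_ind; first exact: unitI_invertible.
move=> J Q iJ sQ Q0 invJ; apply: mulI_invertible => //.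
have iQ := prime_ideal sQ.
have [x [_ xQ [p [q [Qp Qq pqE]]]]] := dedekind_prime_comaximal sQ Q0.
split.
  split; first exact: emb_submodule.
  by exists 1; rewrite ?oner_neq0 // => _ [a _ <-]; exists a; rewrite tofrac1 mul1r.
(* Any nonzero [e] in [Q] is a common denominator for [V], as [x * e] is in [R]. *)
have [e Qe e0] := neq0_ideal iQ Q0; have [d _ dE] := xQ e Qe.
pose V : set K := [set z | exists r s : R, z = r%:F + x * s%:F].
have sV : is_submodule V.
  split=> [|_ _ [r [s ->]] [r' [s' ->]]|c _ [r [s ->]]].
  - by exists 0, 0; rewrite tofrac0 mulr0 addr0.
  - by exists (r + r'), (s + s'); rewrite !tofracD; ring.
  - by exists (c * r), (c * s); rewrite !tofracM; ring.
exists V.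
  split=> //; exists e => // _ [r [s ->]]; exists (e * r + d * s).
  by rewrite tofracD !tofracM dE; ring.
have [sU _] := @unitI_fractional R.
apply/seteqP; split.
  apply: (mulI_sub sU) => _ _ [a Qa <-] [r [s ->]].
  by have [t _ tE] := xQ a Qa; exists (a * r + t * s); rewrite // tofracD !tofracM tE; ring.
have [_ VD VZ] := mulI_submodule (emb Q) V.
move=> _ [a _ <-]; rewrite -[a%:F]mulr1; apply: VZ; rewrite pqE.
rewrite -[p%:F]mulr1 [x * _]mulrC; apply: VD; apply: mulI_in.
- by exists p.
- by exists 1, 0; rewrite tofrac1 tofrac0 mulr0 addr0.
- by exists q.
- by exists 0, 1; rewrite tofrac1 tofrac0 mulr1 add0r.
Qed.

Lemma dedekind_prufer : prufer_domain R.
Proof.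
move=> A [s ->]; apply: dedekind_invertible; exact: ideal_gen_ideal.
Qed.

(** * Torsion of the class group *)

(** By induction on [I]: if [J Q] contains a power of each element of [P] then so
does [Q], which is therefore [P], and so does [J]. *)
Lemma dedekind_primary_power P (A : inv_ideal R) : Spec R P -> P <> [set 0] ->
  ideal_set A = emb P ->
  forall I, is_ideal I -> I <> [set 0] ->
    (forall p, P p -> exists n, I (p ^+ n)) ->
  exists k, emb I = ideal_set (A ^+ k)%g.
Proof.
move=> sP P0 AP I iI I0 Irad.
pose Phi X := (forall p, P p -> exists n, X (p ^+ n)%:F) ->
  exists k, X = ideal_set (A ^+ k)%g.
suff : Phi (emb I).
  by apply=> p /Irad[n Ipn]; exists n; exists (p ^+ n).
apply: dedekind_ideal_ind iI I0 => [_|J Q iJ sQ Q0 PhiJ JQrad]; first by exists 0%N.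
have iQ := prime_ideal sQ; have [iP nP1 _] := sP.
have JQ_Q : mulI (emb J) (emb Q) `<=` emb Q.
  apply: (mulI_sub (emb_submodule iQ)) => _ _ [a _ <-] [q Qq <-].
  by exists (a * q); rewrite ?tofracM //; apply: idealMl.
have JQ_J : mulI (emb J) (emb Q) `<=` emb J.
  apply: (mulI_sub (emb_submodule iJ)) => _ _ [a Ja <-] [q _ <-].
  by exists (a * q); rewrite ?tofracM //; apply: idealMr.
have PQ : P `<=` Q.
  by move=> p /JQrad[n /JQ_Q/emb_tofrac Qpn]; apply: prime_exp Qpn.
have QE : Q = P.
  have [_ _ maxR] := dedR; have [_ _ /(_ Q iQ PQ)] := maxR P sP P0.
  by case=> // QE; have [_ []] := sQ; rewrite QE.
have [k kE] : exists k, emb J = ideal_set (A ^+ k)%g.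
  by apply: PhiJ => p /JQrad[n /JQ_J Jpn]; exists n.
by exists k.+1; rewrite expgSr QE kE -AP.
Qed.

Lemma ideal_class_eq1 (A : inv_ideal R) : ideal_class A = 1%g <-> principal_inv_ideal A.
Proof.
rewrite -[A in principal_inv_ideal A]mul1g -[X in (X * _)%g]invg1.
by split=> [/esym/ideal_classP|/ideal_classP/esym].
Qed.

Lemma ideal_classX (A : inv_ideal R) n : ideal_class (A ^+ n)%g = (ideal_class A ^+ n)%g.
Proof. by elim: n => [|n IHn] //; rewrite !expgS ideal_classM IHn. Qed.

Lemma principal_invertible x : x != 0 -> invertible (principalI x).
Proof.
have frac y : fractional_ideal (principalI y).
  split; first exact: principal_submodule.
  have [a [b [b0 ->]]] := fraction_div y; exists b => // _ [c _ <-].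
  by exists (a * c); rewrite tofracM mulrA [b%:F * _]mulrC divfK ?tofrac_eq0.
move=> x0; split=> //; exists (principalI x^-1) => //.
by rewrite mulI_principal divff // -unitIE.
Qed.

(** A principal ideal with radical [Q] is a power of [Q], with positive exponent as it
is proper, so primes have torsion classes. Products inherit this, hence so do all
nonzero ideals of [R], and every invertible fractional ideal is in the class of
one of those. *)
Lemma dedekind_torsion :
  (forall P, Spec R P -> radical_principal P) -> torsion_group (class_group R).
Proof.
move=> radR.
pose torsion (g : class_group R) := exists2 n : nat, (0 < n)%N & (g ^+ n = 1)%g.
have torsionM g h : torsion g -> torsion h -> torsion (g * h)%g.
  move=> [n n0 gn] [m m0 hm]; exists (n * m)%N; first by rewrite muln_gt0 n0.
  rewrite expgMn; last exact: class_mulC.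
  by rewrite expgnA gn mulnC expgnA hm !expg1n mulg1.
pose Phi X := exists2 A : inv_ideal R, ideal_set A = X & torsion (ideal_class A).
have PhiI I : is_ideal I -> I <> [set 0] -> Phi (emb I).
  apply: dedekind_ideal_ind => [|J Q iJ sQ Q0 [A AJ tA]].
    by exists 1%g => //; exists 1%N => //; rewrite expg1.
  pose B := InvIdeal (dedekind_invertible (prime_ideal sQ) Q0).
  exists (A * B)%g; first by rewrite /= AJ.
  rewrite ideal_classM; apply: torsionM => //.
  have [s Qs Qrad] := radR Q sQ; have [iQ nQ1 _] := sQ.
  have s0 : s != 0.
    apply/eqP => s0; apply: (Q0); apply/seteqP; split=> [p /Qrad[n [r]]|_ ->]; last first.
      exact: ideal0.
    by rewrite s0 mulr0 => /eqP; rewrite expf_eq0 => /andP[_ /eqP].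
  have iI : is_ideal (range ( *%R^~ s)).
    split=> [|_ _ [c _ <-] [d _ <-]|e _ [c _ <-]].
    - by exists 0; rewrite ?mul0r.
    - by exists (c + d); rewrite ?mulrDl.
    - by exists (e * c); rewrite ?mulrA.
  have [|p /Qrad[n [r rE]]|k kE] :=
      @dedekind_primary_power Q B sQ Q0 erefl (range ( *%R^~ s)) iI.
  - move=> I0; have : range ( *%R^~ s) s by exists 1; rewrite ?mul1r.
    by rewrite I0 => /eqP; rewrite (negPf s0).
  - by exists n, r.
  exists k; last first.
    rewrite -ideal_classX; apply/ideal_class_eq1; exists s%:F; first by rewrite tofrac_eq0.
    rewrite -kE; apply/seteqP; split=> [_ [_ [c _ <-] <-]|_ [c _ <-]].
      by exists c; rewrite // tofracM mulrC.
    by exists (c * s); [exists c | rewrite tofracM mulrC].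
  rewrite lt0n; apply/eqP => k0; apply: nQ1.
  have : emb (range ( *%R^~ s)) 1%:F by rewrite kE k0 expg0; exists 1.
  by move=> /emb_tofrac[c _ <-]; apply: idealMl.
move=> g; rewrite -(ideal_class_repr g); set A := repr g.
have [[sA [d d0 dA]] [J _ AJ]] := inv_idealP A.
(* The multiple [d A] of the representative [A] is an ideal of [R]. *)
pose I := [set a | exists2 x, ideal_set A x & a%:F = d%:F * x].
have [A0 AD AZ] := sA.
have iI : is_ideal I.
  split=> [|a b [x Ax aE] [y Ay bE]|c a [x Ax aE]].
  - by exists 0; rewrite ?mulr0 ?tofrac0.
  - by exists (x + y); [exact: AD | rewrite tofracD aE bE mulrDr].
  - by exists (c%:F * x); [exact: AZ | rewrite tofracM aE mulrCA].
have dF0 : d%:F != 0 by rewrite tofrac_eq0.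
have IN0 : I <> [set 0].
  move=> I0; have : mulI (ideal_set A) J `<=` [set 0].
    apply: mulI_sub.
      by split=> [//|_ _ -> ->|a _ ->]; rewrite /= ?addr0 ?mulr0.
    move=> x y Ax _; have [a aE] := dA x Ax.
    have : I a by exists x.
    rewrite I0 => a0; move/eqP: aE; rewrite a0 tofrac0 mulf_eq0 (negPf dF0).
    by move=> /eqP ->; rewrite mul0r.
  move=> AJ0; have /eqP : [set (0 : K)] 1%:F by apply: AJ0; rewrite AJ; exists 1.
  by rewrite tofrac_eq0 oner_eq0.
have [B BI tB] := PhiI I iI IN0.
pose D := InvIdeal (principal_invertible dF0).
have DA : ideal_class D = 1%g by apply/ideal_class_eq1; exists d%:F.
suff BE : B = (D * A)%g by rewrite BE ideal_classM DA class_mul1 in tB.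
apply: inv_ideal_inj; rewrite BI; apply/seteqP; split=> [_ [a [x Ax aE] <-]|].
  by rewrite aE; apply: mulI_in => //; exists 1; rewrite ?tofrac1 ?mulr1.
apply: (mulI_sub (emb_submodule iI)) => _ y [c _ <-] Ay.
have Acy : ideal_set A (c%:F * y) by apply: AZ.
have [a aE] := dA _ Acy; exists a; last by rewrite -aE mulrA.
by exists (c%:F * y).
Qed.

(** If [P ^ n] is generated by [x] with [n > 0], then [x] is in [P] and divides the
[n]-th power of every element of [P]. *)
Lemma torsion_radical_principal :
  torsion_group (class_group R) -> forall P, Spec R P -> radical_principal P.
Proof.
move=> torR P sP; have iP := prime_ideal sP.
have [->|P0] := pselect (P = [set 0]).
  by exists 0 => // p ->; exists 1%N, 0; rewrite mulr0 expr1.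
pose A := InvIdeal (dedekind_invertible iP P0).
have [[|n] // _] := torR (ideal_class A).
rewrite -ideal_classX => /ideal_class_eq1[x x0 AxE].
have A_R k : ideal_set (A ^+ k)%g `<=` @unitI R.
  have [sU _] := unitI_fractional R.
  elim: k => [|k IHk] //; rewrite expgS.
  apply: (mulI_sub sU) => _ _ [a _ <-] /IHk[b _ <-].
  by exists (a * b); rewrite // tofracM.
have A_P : ideal_set (A ^+ n.+1)%g `<=` emb P.
  rewrite expgS; apply: (mulI_sub (emb_submodule iP)) => _ _ [a Pa <-] /A_R[b _ <-].
  by exists (a * b); rewrite ?tofracM //; apply: idealMr.
have [s Ps sE] : emb P x by apply: A_P; rewrite AxE; exists 1; rewrite ?tofrac1 ?mulr1.
exists s => // p Pp; exists n.+1.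
have : ideal_set (A ^+ n.+1)%g (p%:F ^+ n.+1).
  elim: (n.+1) => [|k IHk]; first by exists 1; rewrite ?tofrac1.
  by rewrite expgS exprS; apply: mulI_in => //; exists p.
rewrite AxE -sE => -[r _ rE]; exists r; apply: tofrac_inj.
by rewrite tofracXn tofracM -rE mulrC.
Qed.

End Dedekind.
End QRDomains.

Theorem corollary2p14 (R : idomainType) :
  [/\ noetherian R -> QR_domain R ->
        forall A : set (set R), A `<=` Spec R -> PA_property A,
      prufer_domain R ->
        (forall A : set (set R), A `<=` Spec R -> PA_property A) ->
        QR_domain R
    & dedekind_domain R ->
        ((forall A : set (set R), A `<=` Spec R -> PA_property A) <->
           QR_domain R)
        /\ (QR_domain R <-> torsion_group (class_group R))].
Proof.
have PA_QR : prufer_domain R ->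
    (forall P, Spec R P -> radical_principal P) -> QR_domain R.
  by move=> /prufer_arithmetical; apply: radical_principal_QR.
split=> [noethR QR|prR /PA_radical_principal|dedR].
- by apply: radical_principal_PA; apply: QR_radical_principal.
- exact: PA_QR.
have [noethR _ _] := dedR; have prR := dedekind_prufer dedR.
split; split.
- by move=> /PA_radical_principal; apply: PA_QR.
- by move=> QR; apply: radical_principal_PA; apply: QR_radical_principal.
- by move=> QR; apply: dedekind_torsion => //; apply: QR_radical_principal.
- by move=> torR; apply: PA_QR => //; apply: torsion_radical_principal.
Qed.
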